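(* Let $X$ be a real Banach space such that $X$ and $X^*$ are uniformly convex. Let $A:X\rightrightarrows X^*$ be a maximal monotone operator. Then, for every $x\in D(A)$, $$\operatorname{bd}(Ax)=\operatorname{Limsup}_{y\to x,\,y\neq x}A(y),$$ where $\operatorname{Limsup}_{y\to x,\,y\ne x}A(y)$ is the set of all $x^*\in X^*$ for which there exist sequences $y_n\to x$ in $X$ and $y_n^*\to x^*$ in $X^*$ (both in norm) with $y_n\neq x$ and $y_n^*\in A(y_n)$ for all $n\in\mathbb{N}$.
   Context: $X^*$ is the continuous dual of $X$, $\langle\cdot,\cdot\rangle$ the duality pairing, and $\operatorname{bd}$ denotes the boundary in the norm topology of $X^*$. For a set-valued operator $A:X\rightrightarrows X^*$, $D(A)=\{x\in X: Ax\neq\emptyset\}$. $A$ is monotone if $\langle x^*-y^*,x-y\rangle\ge 0$ whenever $x^*\in Ax$, $y^*\in Ay$, and maximal monotone if in addition its graph is not properly contained in the graph of another monotone operator. *)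

(* Defs.v *)
From HB Require Import structures.
From mathcomp Require Import all_boot all_order all_algebra.
From mathcomp Require Import all_classical all_reals topology normedtype.

Set Implicit Arguments.
Unset Strict Implicit.
Unset Printing Implicit Defensive.

Import Order.TTheory GRing.Theory Num.Theory.
Import numFieldNormedType.Exports.

Local Open Scope classical_set_scope.
Local Open Scope ring_scope.

Section ContinuousDual.
Context (R : realType) (X : normedModType R).

Definition dual_pred : {pred X -> R^o} :=
  mem [set f : X -> R^o | linear f /\ continuous f].

Record dual := Dual { dual_fun :> X -> R^o; dualP : dual_fun \in dual_pred }.

HB.instance Definition _ := [isSub for dual_fun].
HB.instance Definition _ := [Choice of dual by <:].

Lemma dual_submod_closed : submod_closed dual_pred.
Proof.
split=> [|a f g]; rewrite !inE /=.
  split; last exact: cst_continuous.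
  by move=> a x y; rewrite /= scaler0 addr0.
move=> [lf cf] [lg cg]; split; last first.
  move=> x; apply: (@continuousD R R^o X (a *: f) g); last exact: cg.
  by apply: (@continuousZl_tmp R R^o X f a); exact: cf.
move=> b x y /=.
rewrite (_ : (a *: f + g) (b *: x + y) = a *: f (b *: x + y) + g (b *: x + y)) //.
rewrite lf lg !scalerDr !scalerA mulrC -!addrA; congr (_ + _).
by rewrite addrCA.
Qed.

HB.instance Definition _ :=
  GRing.isSubmodClosed.Build R (X -> R^o) dual_pred dual_submod_closed.
HB.instance Definition _ := [SubChoice_isSubLmodule of dual by <:].

Lemma dual_linear (f : dual) : linear f.
Proof. by have := dualP f; rewrite inE => -[]. Qed.

Lemma dual_continuous (f : dual) : continuous f.
Proof. by have := dualP f; rewrite inE => -[]. Qed.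

HB.instance Definition _ (f : dual) :=
  GRing.isLinear.Build R X R^o *:%R (dual_fun f) (dual_linear f).

Lemma dual_ext (f g : dual) : (forall x, f x = g x) -> f = g.
Proof. by move=> fg; apply: val_inj; apply/funext. Qed.

Lemma dualDE (f g : dual) x : (f + g) x = f x + g x.
Proof. by []. Qed.

Lemma dualZE (a : R) (f : dual) x : (a *: f) x = a * f x.
Proof. by []. Qed.

Lemma dualNE (f : dual) x : (- f) x = - f x.
Proof. by []. Qed.

Definition dual_norm (f : dual) : R :=
  sup [set `|f x| | x in [set x : X | `|x| <= 1]].

Lemma dual_norm_has_sup (f : dual) :
  has_sup [set `|f x| | x in [set x : X | `|x| <= 1]].
Proof.
split; first by exists `|f 0|, 0 => //=; rewrite normr0.
have /bounded_funP/(_ 1)[M fM] : bounded_near f (nbhs (0 : X)).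
  exact/linear_bounded_continuous/dual_continuous.
by exists M => _ [x /= x1 <-]; exact: fM.
Qed.

Lemma dual_norm_ge (f : dual) x : `|x| <= 1 -> `|f x| <= dual_norm f.
Proof.
by move=> x1; apply: (sup_upper_bound (dual_norm_has_sup f)); exists x.
Qed.

Lemma dual_norm_le (f : dual) (M : R) :
  (forall x, `|x| <= 1 -> `|f x| <= M) -> dual_norm f <= M.
Proof.
move=> fM; apply: ge_sup; first exact: (dual_norm_has_sup f).1.
by move=> _ [x /= x1 <-]; exact: fM.
Qed.

Lemma dual_norm_ge0 (f : dual) : 0 <= dual_norm f.
Proof.
by apply: le_trans (@dual_norm_ge f 0 _); rewrite // normr0.
Qed.

Lemma dual_normD (f g : dual) : dual_norm (f + g) <= dual_norm f + dual_norm g.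
Proof.
apply: dual_norm_le => x x1; rewrite dualDE (le_trans (ler_normD _ _))//.
by rewrite lerD// dual_norm_ge.
Qed.

Lemma dual_normZ (a : R) (f : dual) : dual_norm (a *: f) = `|a| * dual_norm f.
Proof.
have Zle (b : R) (g : dual) : dual_norm (b *: g) <= `|b| * dual_norm g.
  apply: dual_norm_le => x x1; rewrite dualZE normrM ler_wpM2l//.
  exact: dual_norm_ge.
apply/eqP; rewrite eq_le Zle /=.
have [->|a0] := eqVneq a 0; first by rewrite normr0 mul0r dual_norm_ge0.
rewrite -ler_pdivlMl ?normr_gt0// -normfV.
by rewrite (le_trans _ (Zle _ _))// scalerA mulVf// scale1r.
Qed.

Lemma dual_norm_bound (f : dual) x : `|f x| <= dual_norm f * `|x|.
Proof.
have [->|x0] := eqVneq x 0; first by rewrite linear0 !normr0 mulr0.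
have nx : 0 < `|x| by rewrite normr_gt0.
rewrite -ler_pdivrMr// mulrC -[X in X * _](@ger0_norm R) ?invr_ge0//.
rewrite -normrM -[_ * f x]/(`|x|^-1 *: f x) -linearZ.
by rewrite dual_norm_ge// normrZ ger0_norm ?invr_ge0// mulVf// gt_eqF.
Qed.

Lemma dual_norm_eq0 (f : dual) : dual_norm f = 0 -> f = 0.
Proof.
move=> f0; apply: dual_ext => x; apply/eqP; rewrite -normr_le0.
by rewrite (le_trans (dual_norm_bound f x))// f0 mul0r.
Qed.

HB.instance Definition _ :=
  Lmodule_isNormed.Build R dual dual_normD dual_normZ dual_norm_eq0.

Lemma dual_normE (f : dual) : `|f| = dual_norm f.
Proof. by []. Qed.

End ContinuousDual.

(* For e > 2 the hypotheses on x, y are contradictory, so this is the usual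
   condition over e in ]0, 2]. *)
Definition uniformly_convex (R : realType) (V : normedModType R) : Prop :=
  forall e : R, 0 < e -> exists2 d : R, 0 < d &
    forall x y : V, `|x| = 1 -> `|y| = 1 -> e <= `|x - y| ->
      `|2^-1 *: (x + y)| <= 1 - d.

Definition boundary (T : topologicalType) (E : set T) : set T :=
  closure E `\` E°.

Section MonotoneOperators.
Context (R : realType) (X : normedModType R).
Implicit Types A B : X -> set (dual X).

Definition operator_dom A : set X := [set x | A x !=set0].

Definition operator_graph A : set (X * dual X) := [set p | A p.1 p.2].

Definition monotone A : Prop :=
  forall (x y : X) (x' y' : dual X), A x x' -> A y y' ->
    0 <= (x' - y') (x - y).

Definition maximal_monotone A : Prop :=
  monotone A /\
  forall B, monotone B -> ~ (operator_graph A `<` operator_graph B).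

Definition punctured_Limsup A (x : X) : set (dual X) :=
  [set x' | exists (y : nat -> X) (y' : nat -> dual X),
    [/\ y n @[n --> \oo] --> x,
        y' n @[n --> \oo] --> x' &
        forall n, y n <> x /\ A (y n) (y' n)]].

End MonotoneOperators.

(* Main.v *)
Require Import Defs.
From HB Require Import structures.
From mathcomp Require Import all_boot all_order all_algebra.
From mathcomp Require Import all_classical all_reals topology normedtype.
From mathcomp Require Import interval_inference sequences.
From mathcomp Require Import ring lra.

Set Implicit Arguments.
Unset Strict Implicit.
Unset Printing Implicit Defensive.

Import Order.TTheory GRing.Theory Num.Theory.
Import numFieldNormedType.Exports.

Local Open Scope classical_set_scope.
Local Open Scope ring_scope.

(* If [x'] is in the boundary of [A x], it is in [A x] and there are [z] close
   to [x'] outside of [A x]. As [A] plus the duality map centred at [x] is onto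
   (Rockafellar), some [y' \in A y] satisfies [z - y' \in J (y - x)]. Then
   [y <> x] because [z \notin A x], and monotonicity between [y'] and [x']
   yields [|y - x| = |z - y'| <= |z - x'|]. Conversely, if a ball of radius [r]
   around [x'] were in [A x], testing monotonicity against [x' + (r / 2) g] with
   [g] norming [y_n - x] would give [|y'_n - x'| >= r / 2].
   Surjectivity is obtained without weak compactness: by uniform convexity of
   both spaces, the Fitzpatrick function of [A] plus half the sum of the squared
   norms has a minimizer, squared norms are differentiable, and the optimality
   condition produces the solution. *)

(** * Norming functionals *)

Section Sublinear.
Context (R : realType) (V : lmodType R).
Implicit Types (p q : V -> R) (x y z : V).

Definition sublinear p : Prop :=
  (forall x y, p (x + y) <= p x + p y) /\
  (forall (a : R) x, 0 < a -> p (a *: x) = a * p x).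

Lemma sublinear0 p : sublinear p -> p 0 = 0.
Proof. by case=> _ /(_ 2 0 ltac:(lra)); rewrite scaler0; lra. Qed.

Lemma sublinearZ p (a : R) x : sublinear p -> 0 <= a -> p (a *: x) = a * p x.
Proof.
move=> sp; rewrite le_eqVlt => /predU1P[<-|/sp.2//].
by rewrite scale0r sublinear0// mul0r.
Qed.

Lemma sublinear_geN p x : sublinear p -> - p (- x) <= p x.
Proof.
by move=> sp; have := sp.1 x (- x); rewrite subrr sublinear0//; lra.
Qed.

Lemma inf_sublinear (S : V -> set R) :
  (forall x, has_inf (S x)) ->
  (forall x y a b, S x a -> S y b -> exists2 c, S (x + y) c & c <= a + b) ->
  (forall (k : R) x a, 0 < k -> S x a -> S (k *: x) (k * a)) ->
  sublinear (fun x => inf (S x)).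
Proof.
move=> Sinf SD SZ.
have Zle (k : R) x : 0 < k -> inf (S (k *: x)) <= k * inf (S x).
  move=> k0; rewrite -ler_pdivrMl//; apply: lb_le_inf (Sinf x).1 _ => a Sa.
  by rewrite ler_pdivrMl//; apply: ge_inf; [exact: (Sinf _).2|exact: SZ].
split=> [x y|k x k0].
  rewrite -lerBlDr; apply: lb_le_inf (Sinf x).1 _ => a Sa.
  rewrite lerBlDr -lerBlDl; apply: lb_le_inf (Sinf y).1 _ => b Sb.
  have [c Sc cab] := SD _ _ _ _ Sa Sb.
  rewrite lerBlDl; apply: le_trans cab.
  by apply: ge_inf; first exact: (Sinf _).2.
apply/eqP; rewrite eq_le Zle//= -ler_pdivlMl//.
apply: le_trans (Zle _ _ _); last by rewrite invr_gt0.
by rewrite scalerA mulVf ?gt_eqF// scale1r.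
Qed.

Lemma sublinear_directional p z : sublinear p ->
  exists q, [/\ sublinear q, forall x, q x <= p x & q (- z) <= - p z].
Proof.
move=> sp.
(* [inf (S x)] is the derivative of [p] at [z] in the direction [x]. *)
pose S x := [set p (x + t *: z) - t * p z | t in [set t : R | 0 <= t]].
have Sinf x : has_inf (S x).
  split; first by exists (p (x + 0 *: z) - 0 * p z); exists 0 => /=.
  exists (- p (- x)) => _ [t /= t0 <-].
  have := sp.1 (x + t *: z) (- x).
  by rewrite addrAC subrr add0r sublinearZ//; lra.
exists (fun x => inf (S x)); split.
- apply: inf_sublinear => //
    [x y _ _ [t /= t0 <-] [s /= s0 <-]|k x _ k0 [t /= t0 <-]].
    exists (p (x + y + (t + s) *: z) - (t + s) * p z).
      by exists (t + s) => //=; lra.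
    have := sp.1 (x + t *: z) (y + s *: z).
    by rewrite addrACA -scalerDl; lra.
  exists (k * t); first by rewrite /= mulr_ge0// ltW.
  by rewrite -scalerA -scalerDr sp.2// mulrBr mulrA.
- move=> x; apply: ge_inf; first exact: (Sinf x).2.
  by exists 0 => //=; rewrite scale0r addr0 mul0r subr0.
- apply: ge_inf; first exact: (Sinf _).2.
  by exists 1 => //=; rewrite scale1r addNr sublinear0// mul1r sub0r.
Qed.

Lemma minimal_sublinear p : sublinear p ->
  exists q, [/\ sublinear q, forall x, q x <= p x &
    forall q', sublinear q' -> (forall x, q' x <= q x) -> q' = q].
Proof.
move=> sp.
pose T := {q : V -> R | sublinear q /\ forall x, q x <= p x}.
pose le (s t : T) := `[< forall x, sval t x <= sval s x >].
have [||||[q [sq qp]] qmin] := @Zorn T le.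
- by move=> t; apply/asboolP.
- move=> r s t /asboolP rs /asboolP st; apply/asboolP => x.
  exact: le_trans (st x) (rs x).
- move=> [s ps] [t pt] /asboolP /= st /asboolP /= ts; apply: eq_exist.
  by apply/funext => x; apply/eqP; rewrite eq_le st ts.
- move=> A Atot.
  have [[t0 At0]|/set0P/negP/negPn/eqP->] := pselect (A !=set0); last first.
    by exists (exist _ p (conj sp (fun=> lexx _))).
  pose S x := [set sval t x | t in A].
  have Sinf x : has_inf (S x).
    split; first by exists (sval t0 x), t0.
    exists (- p (- x)) => _ [[t [st tp]] At /= <-].
    by apply: le_trans (sublinear_geN x st); rewrite lerN2.
  have sS : sublinear (fun x => inf (S x)).
    apply: inf_sublinear => //
      [x y _ _ [t At <-] [s As <-]|k x _ k0 [t At <-]].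
      have [/asboolP|/asboolP] := Atot _ _ At As => ts.
        exists (sval s (x + y)); first by exists s.
        by apply: le_trans ((svalP s).1.1 _ _) _; rewrite lerD2r.
      exists (sval t (x + y)); first by exists t.
      by apply: le_trans ((svalP t).1.1 _ _) _; rewrite lerD2l.
    by exists t => //; rewrite (svalP t).1.2.
  have Sp x : inf (S x) <= p x.
    apply: le_trans ((svalP t0).2 x); apply: ge_inf; first exact: (Sinf x).2.
    by exists t0.
  pose P (q : V -> R) := sublinear q /\ forall x, q x <= p x.
  have sSp : P (fun x => inf (S x)) by [].
  exists (exist P _ sSp) => s As; apply/asboolP => x /=.
  by apply: ge_inf; [exact: (Sinf x).2|exists s].
exists q; split=> // q' sq' q'q.
have q'p x : q' x <= p x by apply: le_trans (qp x).
by have /(congr1 sval) := qmin (exist _ q' (conj sq' q'p)) ltac:(exact/asboolP).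
Qed.

(* A minimal sublinear function coincides with its directional derivatives. *)
Lemma linear_minorant p : sublinear p ->
  exists2 f : V -> R^o, linear f & forall x, f x <= p x.
Proof.
move=> /minimal_sublinear[q [sq qp qmin]]; exists q => //.
have qN x : q (- x) = - q x.
  have [q' [sq' q'q q'N]] := sublinear_directional x sq.
  move: q'N; rewrite (qmin _ sq' q'q) => qN.
  by apply/eqP; rewrite eq_le qN /= lerNl sublinear_geN.
have qD x y : q (x + y) = q x + q y.
  apply/eqP; rewrite eq_le sq.1 /=.
  by have := sq.1 (x + y) (- y); rewrite addrK qN; lra.
move=> a x y; rewrite qD; congr (_ + _).
have [a0|a0] := leP 0 a; first by rewrite sublinearZ.
by rewrite -[a *: x]opprK -scaleNr qN sublinearZ ?oppr_ge0 ?ltW// mulNr opprK.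
Qed.

End Sublinear.

Section Duality.
Context (R : realType) (X : normedModType R).

Lemma norm_sublinear : sublinear (fun x : X => `|x|).
Proof.
by split=> [|a x a0]; [exact: ler_normD|rewrite normrZ gtr0_norm].
Qed.

Lemma dual_of_linear (f : X -> R^o) (C : R) : linear f ->
  (forall x, `|f x| <= C * `|x|) -> exists g : dual X, forall x, g x = f x.
Proof.
move=> lf fC.
pose L := GRing.isLinear.Build _ _ _ _ _ lf.
pose F : {linear X -> R^o} := HB.pack f L.
suff cF : continuous F by exists (Dual (mem_set (conj lf cF))).
apply: bounded_linear_continuous; apply/bounded_funP => r.
exists (`|C| * r) => x xr; apply: le_trans (fC x) _.
apply: le_trans (ler_wpM2r (normr_ge0 x) (ler_norm C)) _.
exact: ler_wpM2l.
Qed.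

Lemma norming_functional (x : X) :
  exists2 f : dual X, f x = `|x| & forall y, `|f y| <= `|y|.
Proof.
have [q [sq qn qx]] := sublinear_directional x norm_sublinear.
have [f lf fq] := linear_minorant sq.
pose L := GRing.isLinear.Build _ _ _ _ _ lf.
pose F : {linear X -> R^o} := HB.pack f L.
have fN y : f (- y) = - f y by exact: (linearN F).
have fle y : f y <= `|y| by exact: le_trans (fq y) (qn y).
have fn y : `|f y| <= `|y|.
  by rewrite ler_norml fle andbT lerNl -fN -normrN fle.
have [g gf] := @dual_of_linear f 1 lf (fun y => ltac:(by rewrite mul1r)).
exists g; last by move=> y; rewrite gf.
apply/eqP; rewrite gf eq_le fle /=.
by have := le_trans (fq (- x)) qx; rewrite fN lerN2.
Qed.

End Duality.

Definition seq_complete (R : realType) (V : normedModType R) : Prop :=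
  forall u : nat -> V,
    (forall e : R, 0 < e -> exists N, forall m n, (N <= m)%N -> (N <= n)%N ->
      `|u m - u n| < e) ->
    exists l : V, u n @[n --> \oo] --> l.

Section Completeness.
Context (R : realType).

Lemma complete_seq_complete (V : completeNormedModType R) : seq_complete V.
Proof.
move=> u uC; suff : cvg (u @ \oo) by move=> ?; exists (lim (u @ \oo)).
apply: cauchy_cvg; apply: cauchy_exP => e e0.
have [N uN] := uC _ e0; exists (u N); exists N => // n /= Nn.
by rewrite -ball_normE /=; apply: uN.
Qed.

Lemma norm_lim_le (V : normedModType R) (u : nat -> V) l (C : R) :
  u n @[n --> \oo] --> l -> (\forall n \near \oo, `|u n| <= C) -> `|l| <= C.
Proof. by move=> ul uC; apply: cvgr_to_le uC; exact: cvg_norm. Qed.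

Lemma dual_seq_complete (X : normedModType R) : seq_complete (dual X).
Proof.
move=> f fC.
have fxC x : exists l : R^o, f n x @[n --> \oo] --> l.
  apply: (@complete_seq_complete R^o) => e e0.
  have x1 : 0 < `|x| + 1 by rewrite ltr_wpDl.
  have [N fN] := fC _ (divr_gt0 e0 x1); exists N => m n Nm Nn.
  rewrite -[f m x - f n x]/((f m - f n) x).
  apply: le_lt_trans (dual_norm_bound _ _) _.
  have := fN _ _ Nm Nn; rewrite ltr_pdivlMr// dual_normE => fmn.
  apply: le_lt_trans fmn; rewrite ler_wpM2l ?dual_norm_ge0//; lra.
have /choice[g fg] := fxC.
have lg : linear g.
  move=> a x y; apply: (cvg_unique _ (fg (a *: x + y))).
    exact: norm_hausdorff.
  rewrite (_ : (fun n => _) = fun n => a *: f n x + f n y); last first.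
    by apply/funext => n; exact: dual_linear.
  by apply: cvgD (fg y); apply: cvgZl_tmp; exact: fg.
have [N0 fN0] := fC 1 ltr01.
have gb x : `|g x| <= (dual_norm (f N0) + 1) * `|x|.
  apply: norm_lim_le (fg x) _; exists N0 => // n /= N0n.
  apply: le_trans (dual_norm_bound _ _) _; apply: ler_wpM2r => //.
  have := fN0 _ _ N0n (leqnn N0); have := ler_normD (f n - f N0) (f N0).
  by rewrite subrK !dual_normE; lra.
have [h hg] := dual_of_linear lg gb.
exists h; apply/cvgrPdist_le => e e0; have [N fN] := fC _ e0.
exists N => // n /= Nn; rewrite dual_normE; apply: dual_norm_le => x x1.
rewrite dualDE dualNE hg; apply: (@norm_lim_le R^o (fun m => f m x - f n x)).
  by apply: cvgB (fg x) _; exact: cvg_cst.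
exists N => // m /= Nm; rewrite -[f m x - f n x]/((f m - f n) x).
by apply: le_trans (dual_norm_ge _ x1) _; rewrite -dual_normE ltW// fN.
Qed.

Lemma prod_seq_complete (V W : normedModType R) :
  seq_complete V -> seq_complete W -> seq_complete (V * W)%type.
Proof.
move=> Vc Wc u uC.
have [l1 ul1] : exists l : V, (u n).1 @[n --> \oo] --> l.
  apply: Vc => e /uC[N uN]; exists N => m n Nm Nn.
  by apply: le_lt_trans (uN m n Nm Nn); rewrite prod_normE le_max lexx.
have [l2 ul2] : exists l : W, (u n).2 @[n --> \oo] --> l.
  apply: Wc => e /uC[N uN]; exists N => m n Nm Nn.
  by apply: le_lt_trans (uN m n Nm Nn); rewrite prod_normE le_max lexx orbT.
exists (l1, l2); under eq_fun do rewrite [u _]surjective_pairing.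
exact: cvg_pair.
Qed.

End Completeness.

(** * Minimization under uniform convexity *)

(* The modulus [d] may depend on the radius [M]: otherwise the squared norm of a
   uniformly convex space would not qualify. *)
Definition uniformly_midconvex (R : realType) (V : normedModType R)
    (Q : V -> R) : Prop :=
  forall M e : R, 0 < e -> exists2 d : R, 0 < d &
    forall u v : V, `|u| <= M -> `|v| <= M -> e <= `|u - v| ->
      Q (2^-1 *: (u + v)) <= (Q u + Q v) / 2 - d.

Section UniformConvexity.
Context (R : realType).

Lemma sqnorm_midconvex (V : normedModType R) :
  uniformly_convex V -> uniformly_midconvex (fun u : V => `|u| ^+ 2).
Proof.
move=> uc M e e0.
pose M' := `|M| + 1; have M'0 : 0 < M' by rewrite ltr_wpDl.
have e'0 : 0 < 3 * e / (4 * M') by rewrite divr_gt0//; lra.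
have [d0 d00 ucd] := uc _ e'0.
exists (Num.min (e ^+ 2 / 64) (e ^+ 2 * d0 / 8)).
  by rewrite lt_min !divr_gt0 ?mulr_gt0 ?exprn_gt0//; lra.
move=> u v; wlog vu : u v / `|v| <= `|u|.
  move=> H uM vM euv; have [?|/ltW ?] := leP `|v| `|u|; first exact: H.
  by rewrite addrC [_ ^+ 2 + _]addrC H// distrC.
move=> uM vM euv; set d := Num.min _ _.
have du : d <= e ^+ 2 / 64 by rewrite ge_min lexx.
have dv : d <= e ^+ 2 * d0 / 8 by rewrite ge_min lexx orbT.
set a := `|u| in vu uM *; set b := `|v| in vu vM *.
have b0 : 0 <= b := normr_ge0 v.
have eab : e <= a + b by apply: le_trans euv (ler_normB _ _).
have a0 : 0 < a by lra.
set n := `|2^-1 *: (u + v)|; have n0 : 0 <= n := normr_ge0 _.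
have nE : `|u + v| = 2 * n.
  by rewrite /n normrZ (@gtr0_norm R 2^-1) ?invr_gt0//; lra.
(* If the norms differ by [e / 4], strong convexity of the square is enough;
   otherwise uniform convexity applies to the normalized vectors. *)
have [ab|ab] := leP (e / 4) (a - b).
  have : 2 * n <= a + b by rewrite -nE ler_normD.
  by nra.
have b1 : e / 4 < b by lra.
have bp : 0 < b by lra.
have aM' : a <= M' by apply: le_trans uM _; rewrite ler_wpDr// ler_norm.
have u1 : `|a^-1 *: u| = 1 by rewrite normrZ normfV normr_id mulVf ?gt_eqF.
have v1 : `|b^-1 *: v| = 1 by rewrite normrZ normfV normr_id mulVf ?gt_eqF.
have sep : 3 * e / (4 * M') <= `|a^-1 *: u - b^-1 *: v|.
  have E : a * `|a^-1 *: u - b^-1 *: v| = `|u - v - (a / b - 1) *: v|.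
    rewrite -{1}(gtr0_norm a0) -normrZ scalerBr !scalerA mulfV ?gt_eqF//.
    by rewrite scale1r scalerBl scale1r opprB addrA subrK.
  have L : `|u - v| - (a - b) <= `|u - v - (a / b - 1) *: v|.
    apply: le_trans (lerB_dist _ _); rewrite lerD2l lerN2 normrZ -/b.
    have ab1 : 0 <= a / b - 1 by rewrite subr_ge0 ler_pdivlMr// mul1r.
    by rewrite ger0_norm// mulrBl mulfVK ?gt_eqF// mul1r.
  rewrite ler_pdivrMr; last lra.
  set t := `| _ | in E *; have t0 : 0 <= t := normr_ge0 _.
  by move: L; rewrite -E; nra.
have := ucd _ _ u1 v1 sep; set k := `| _ | => kd.
have k0 : 0 <= k := normr_ge0 _.
have nle : 2 * n <= 2 * b * (1 - d0) + (a - b).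
  have -> : 2 * n = `|(2 * b) *: (2^-1 *: (a^-1 *: u + b^-1 *: v)) +
                     (a - b) *: (a^-1 *: u)|.
    rewrite -nE; congr `| _ |.
    rewrite scalerA (_ : 2 * b / 2 = b); last by lra.
    rewrite scalerDr addrAC -scalerDl subrKC.
    by rewrite !scalerA !mulfV ?gt_eqF// !scale1r.
  apply: le_trans (ler_normD _ _) _.
  rewrite [X in X + _]normrZ [X in _ + X]normrZ u1 mulr1 -/k.
  rewrite !ger0_norm; [nra|lra|lra].
have : n ^+ 2 <= ((a + b) / 2 - b * d0) ^+ 2.
  by apply: lerXn2r; rewrite ?nnegrE; lra.
have : e ^+ 2 * d0 / 8 <= b * d0 * a.
  have : (e / 4) * (e / 2) <= b * a by apply: ler_pM; lra.
  by nra.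
have : b * d0 * (b * d0) <= b * d0 * b by rewrite ler_wpM2l//; nra.
by nra.
Qed.

Lemma affine_perturbation_min (V : normedModType R) (Q : V -> R)
    (I : Type) (l : I -> V -> R) :
  seq_complete V ->
  uniformly_midconvex Q -> continuous Q -> (forall u, `|u| ^+ 2 <= Q u) ->
  (forall i u v, l i (2^-1 *: (u + v)) = (l i u + l i v) / 2) ->
  (forall i, continuous (l i)) ->
  (exists i (c : R), forall u, - c * (1 + `|u|) <= l i u) ->
  (exists u (s : R), forall i, Q u + l i u <= s) ->
  exists p (m : R), (forall i, Q p + l i p <= m) /\
    forall u (s : R), (forall i, Q u + l i u <= s) -> m <= s.
Proof.
move=> Vc Quc Qcont Qge lmid lcont [i0 [c' lc']] [u0 [s0 us0]].
pose c : R := `|c'|; have c0 : 0 <= c := normr_ge0 _.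
have lc u : - c * (1 + `|u|) <= l i0 u.
  apply: le_trans (lc' u); rewrite ler_wpM2r ?addr_ge0//.
  by rewrite lerN2 ler_norm.
pose E := [set s : R | exists u, forall i, Q u + l i u <= s].
have Einf : has_inf E.
  split; first by exists s0, u0.
  exists (- c - c ^+ 2) => s [u /(_ i0)].
  by have := lc u; have := Qge u; have := sqr_ge0 (`|u| - c / 2); nra.
pose m : R := inf E.
have mle u (s : R) : (forall i, Q u + l i u <= s) -> m <= s.
  by move=> us; apply: ge_inf; [exact: Einf.2|exists u].
have : forall n, exists u, forall i, Q u + l i u <= m + n.+1%:R^-1 :> R.
  move=> n; have n0 : 0 < n.+1%:R^-1 :> R by rewrite invr_gt0.
  have [s [u us] sm] := inf_adherent n0 Einf.
  by exists u => i; apply: le_trans (us i) (ltW _).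
move=> /choice[u uP].
have inv_small (e : R) : 0 < e ->
    exists N, forall n, (N <= n)%N -> n.+1%:R^-1 <= e :> R.
  move=> e0; have [N _ NP] : \forall n \near \oo, n.+1%:R^-1 < e :> R.
    by move: e e0 => _/posnumP[e]; exact: near_infty_natSinv_lt.
  by exists N => n /NP /ltW.
have [M uM] : exists M, forall n, `|u n| <= M.
  pose k : R := `|m|; have mk : m <= k := ler_norm m.
  have k0 : 0 <= k := normr_ge0 m.
  exists (2 * c + k + 2) => n; rewrite leNgt; apply/negP => lt.
  have n1 : n.+1%:R^-1 <= 1 :> R by rewrite invf_le1 ?ler1n ?ltr0n.
  have : `|u n| * 1 <= `|u n| * (`|u n| - c).
    by rewrite ler_wpM2l//; lra.
  move: n1 (uP n i0) (lc (u n)) (Qge (u n)).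
  by generalize (n.+1%:R^-1 : R) => r *; lra.
have [p up] : exists p : V, u n @[n --> \oo] --> p.
  apply: Vc => e e0; have [d d0 dP] := Quc M e e0.
  have [N NP] := inv_small (d / 2) ltac:(lra).
  exists N => j k /NP Nj /NP Nk; rewrite ltNge; apply/negP => ejk.
  have := dP _ _ (uM j) (uM k) ejk => Qm.
  have : m <= m - d / 2.
    apply: (mle (2^-1 *: (u j + u k))) => i; rewrite lmid.
    move: Nj Nk (uP j i) (uP k i).
    by generalize (j.+1%:R^-1 : R) (k.+1%:R^-1 : R) => r s *; lra.
  by lra.
exists p, m; split=> // i; apply/ler_addgt0Pr => e e0.
have [N NP] := inv_small e e0.
apply: (@cvgr_to_le _ \oo _ R (fun n => Q (u n) + l i (u n))).
  have Qup : Q (u n) @[n --> \oo] --> Q p by exact: cvg_comp up (Qcont p).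
  have lup : l i (u n) @[n --> \oo] --> l i p by exact: cvg_comp up (lcont i p).
  exact: (@cvgD R R^o _ \oo _ (fun n => Q (u n)) (fun n => l i (u n)) _ _
    Qup lup).
by exists N => // n /= /NP ne; apply: le_trans (uP n i) _; rewrite lerD2l.
Qed.

End UniformConvexity.

(** * The duality map *)

(* The pairing [b] is abstract because both [X] against its dual and the dual
   against [X] are needed. *)
Section Smoothness.
Context (R : realType) (V W : normedModType R) (b : V -> W -> R).
Hypothesis b_le : forall v w, b v w <= `|v| * `|w|.
Hypothesis bDl : forall v (t : R) h w, b (v + t *: h) w = b v w + t * b h w.
Hypothesis bmid : forall v w w', b v (2^-1 *: (w + w')) = (b v w + b v w') / 2.
Hypothesis bB : forall v w w', b v (w - w') = b v w - b v w'.

Lemma duality_norm v w :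
  `|v| ^+ 2 + `|w| ^+ 2 <= 2 * b v w -> `|v| = `|w|.
Proof.
move=> vw; apply/eqP; rewrite -subr_eq0 -sqrf_eq0.
have := b_le v w; have := sqr_ge0 (`|v| - `|w|) => ge le.
by rewrite eq_le ge andbT; nra.
Qed.

Lemma pairing_le_sq v w : 2 * b v w <= `|v| ^+ 2 + `|w| ^+ 2.
Proof. by have := b_le v w; have := sqr_ge0 (`|v| - `|w|); nra. Qed.

(* [t |-> |v + t h|^2] lies above its tangent given by [w], and the opposite
   bound comes from the functionals dual to [v + t h], which tend to [w] by
   uniform convexity. *)
Lemma sqnorm_differentiable v0 w0 h (e : R) : uniformly_convex W ->
  (forall v, exists w, `|v| ^+ 2 + `|w| ^+ 2 <= 2 * b v w) ->
  `|v0| ^+ 2 + `|w0| ^+ 2 <= 2 * b v0 w0 -> 0 < e ->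
  exists2 tau : R, 0 < tau & forall t, 0 < t -> t < tau ->
    `|v0 + t *: h| ^+ 2 <= `|v0| ^+ 2 + 2 * t * (b h w0 + e).
Proof.
move=> Wuc dual vw0 e0.
set H := `|h|; have H0 : 0 <= H := normr_ge0 h.
pose M : R := `|v0| + H + 1; have M0 : 1 <= M.
  by have := normr_ge0 v0; rewrite /M; lra.
have e'0 : 0 < e / (H + 1) by rewrite divr_gt0//; lra.
have [d d0 dP] := sqnorm_midconvex Wuc M e'0.
have D0 : 0 < 4 * M * (H + 1) by rewrite !mulr_gt0//; lra.
exists (Num.min 1 (d / (4 * M * (H + 1)))).
  by rewrite lt_min ltr01 divr_gt0.
move=> t t0; rewrite lt_min ltr_pdivlMr// => /andP[t1 td].
have [w vw] := dual (v0 + t *: h).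
have wM : `|w| <= M.
  rewrite -(duality_norm vw); apply: le_trans (ler_normD _ _) _.
  by rewrite normrZ (gtr0_norm t0) -/H /M; nra.
have w0M : `|w0| <= M by rewrite -(duality_norm vw0) /M; lra.
rewrite bDl in vw.
have below := pairing_le_sq (v0 + t *: h) w0; rewrite bDl in below.
have bhw : b h w - b h w0 <= H * `|w - w0| by rewrite -bB b_le.
have [ew|we] := leP (e / (H + 1)) `|w - w0|.
  have := dP _ _ wM w0M ew.
  have := pairing_le_sq v0 (2^-1 *: (w + w0)); rewrite bmid.
  set q := `|2^-1 *: _|.
  have ww : `|w - w0| <= 2 * M by apply: le_trans (ler_normB _ _) _; lra.
  have tHM : t * (b h w - b h w0) <= t * (H * (2 * M)).
    by rewrite ler_wpM2l ?(ltW t0)//; apply: le_trans bhw _; rewrite ler_wpM2l.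
  have tM : 0 < t * M by rewrite mulr_gt0//; lra.
  have tMH : t * (H * (2 * M)) <= d / 2 by nra.
  by move=> *; exfalso; lra.
have He : H * `|w - w0| <= e.
  apply: le_trans (_ : H * (e / (H + 1)) <= e).
    by rewrite ler_wpM2l// ltW.
  by rewrite mulrA ler_pdivrMr; nra.
have := pairing_le_sq v0 w.
have : t * (b h w - b h w0) <= t * e by rewrite ler_wpM2l ?(ltW t0)//; lra.
by lra.
Qed.

End Smoothness.

Section DualityMap.
Context (R : realType) (X : normedModType R).
Implicit Types (x : X) (f : dual X).

Lemma dual_le f x : f x <= `|x| * `|f|.
Proof.
by rewrite mulrC; apply: le_trans (ler_norm _) _; exact: dual_norm_bound.
Qed.

Lemma dual_linearD f x (t : R) y : f (x + t *: y) = f x + t * f y.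
Proof. by rewrite addrC dual_linear addrC. Qed.

Lemma dual_linearZ f (t : R) x : f (t *: x) = t * f x.
Proof. by rewrite -[t *: x]add0r dual_linearD linear0 add0r. Qed.

Lemma dual_linearN f x : f (- x) = - f x.
Proof. by rewrite -scaleN1r dual_linearZ mulN1r. Qed.

Lemma dual_additive f x y : f (x + y) = f x + f y.
Proof. by rewrite -[y in LHS]scale1r dual_linearD mul1r. Qed.

Lemma duality_map_ex x :
  exists f : dual X, `|x| ^+ 2 + `|f| ^+ 2 <= 2 * f x.
Proof.
have [f fx fn] := norming_functional x; exists (`|x| *: f).
have nf : `|f| <= 1 by apply: dual_norm_le => y; apply: le_trans.
rewrite normrZ normr_id exprMn dualZE fx.
have : `|f| ^+ 2 <= 1 by rewrite expr_le1.
by have := sqr_ge0 `|x|; nra.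
Qed.

Lemma sqnorm_continuous (V : normedModType R) :
  continuous (fun v : V => `|v| ^+ 2).
Proof.
move=> v; have nv := @norm_continuous _ V v.
exact: (@cvgM _ _ (nbhs v) _ _ _ _ _ nv nv).
Qed.

Lemma duality_map_onto f : seq_complete X -> uniformly_convex X ->
  exists x, `|x| ^+ 2 + `|f| ^+ 2 <= 2 * f x.
Proof.
move=> Xc Xuc; have [->|f0] := eqVneq f 0.
  exists 0; rewrite !normr0 linear0; lra.
have nf : 0 < `|f| by rewrite normr_gt0.
have [|||||||p [m [pm mle]]] := @affine_perturbation_min R X
  (fun v => `|v| ^+ 2) unit (fun _ v => - 2 * f v) Xc.
- exact: sqnorm_midconvex.
- exact: sqnorm_continuous.
- by [].
- by move=> _ u v; rewrite dual_linearZ dual_additive; lra.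
- move=> _ v; apply: (@cvgZl_tmp R R^o); exact: dual_continuous.
- exists tt, (2 * `|f|) => u; have := dual_le f u; have := normr_ge0 u; nra.
- by exists 0, (`|0 : X| ^+ 2 + - 2 * f 0).
have {}pm := pm tt; have {}mle u := mle u _ (fun=> lexx _).
exists p.
suff : `|f| <= (`|f| ^+ 2 - m) / (2 * `|f|).
  by rewrite ler_pdivlMr; nra.
apply: dual_norm_le => y y1; rewrite ler_pdivlMr; last by lra.
have [s s1 ->] : exists2 s : R, `|s| = 1 & `|f y| = s * f y.
  have [fy|fy] := leP 0 (f y).
    by exists 1; [exact: normr1|rewrite mul1r ger0_norm].
  by exists (-1); [exact: normrN1|rewrite mulN1r ltr0_norm].
have := mle ((`|f| * s) *: y).
rewrite dual_linearZ normrZ normrM s1 mulr1 normr_id.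
have : (`|f| * `|y|) ^+ 2 <= `|f| ^+ 2.
  by rewrite exprMn ler_piMr ?exprn_ge0// expr_le1.
by lra.
Qed.

End DualityMap.

(** * Surjectivity of maximal monotone perturbations of the duality map *)

Section Surjectivity.
Context (R : realType) (X : completeNormedModType R).
Hypotheses (Xuc : uniformly_convex X) (Duc : uniformly_convex (dual X)).

Lemma eval_continuous (x : X) : continuous (fun f : dual X => f x : R^o).
Proof.
move=> f; apply/(@cvgrPdist_lt R R^o _ (nbhs f)) => e e0.
have x1 : 0 < `|x| + 1 by rewrite ltr_wpDl.
apply/nbhs_ballP; exists (e / (`|x| + 1)); first exact: divr_gt0.
move=> g; rewrite -ball_normE /= => fg.
rewrite -[f x - g x]/((f - g) x); apply: le_lt_trans (dual_norm_bound _ _) _.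
rewrite -dual_normE; move: fg; rewrite ltr_pdivlMr// => fg.
by apply: le_lt_trans fg; rewrite ler_wpM2l//; lra.
Qed.

Lemma prod_sqnorm_midconvex :
  uniformly_midconvex (fun u : X * dual X => `|u.1| ^+ 2 + `|u.2| ^+ 2).
Proof.
have mid0 (V : normedModType R) (u v : V) :
    `|2^-1 *: (u + v)| ^+ 2 <= (`|u| ^+ 2 + `|v| ^+ 2) / 2.
  rewrite normrZ (@gtr0_norm R 2^-1) ?invr_gt0//.
  have := ler_normD u v; have := normr_ge0 (u + v).
  have := sqr_ge0 (`|u| - `|v|); nra.
move=> M e e0.
have [d1 d10 dP1] := sqnorm_midconvex Xuc M e0.
have [d2 d20 dP2] := sqnorm_midconvex Duc M e0.
exists (Num.min d1 d2); first by rewrite lt_min d10.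
have d1m : Num.min d1 d2 <= d1 by rewrite ge_min lexx.
have d2m : Num.min d1 d2 <= d2 by rewrite ge_min lexx orbT.
move=> u v; rewrite !prod_normE !ge_max => /andP[u1 u2] /andP[v1 v2].
rewrite le_max => /orP[] e12 /=.
  have := dP1 _ _ u1 v1 e12; have := mid0 _ u.2 v.2; lra.
have := dP2 _ _ u2 v2 e12; have := mid0 _ u.1 v.1; lra.
Qed.

Lemma sqnorm_dual_differentiable (x h : X) (f : dual X) (e : R) :
  `|x| ^+ 2 + `|f| ^+ 2 <= 2 * f x -> 0 < e ->
  exists2 tau : R, 0 < tau & forall t, 0 < t -> t < tau ->
    `|x + t *: h| ^+ 2 <= `|x| ^+ 2 + 2 * t * (f h + e).
Proof.
apply: (@sqnorm_differentiable R X (dual X) (fun x f => f x)) => //.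
- by move=> v w; exact: dual_le.
- by move=> v t k w; rewrite dual_linearD.
- by move=> v w w'; rewrite dualZE dualDE mulrC.
- exact: duality_map_ex.
Qed.

Lemma dual_sqnorm_differentiable (f h : dual X) (x : X) (e : R) :
  `|x| ^+ 2 + `|f| ^+ 2 <= 2 * f x -> 0 < e ->
  exists2 tau : R, 0 < tau & forall t, 0 < t -> t < tau ->
    `|f + t *: h| ^+ 2 <= `|f| ^+ 2 + 2 * t * (h x + e).
Proof.
rewrite addrC.
apply: (@sqnorm_differentiable R (dual X) X (fun f x => f x)) => //.
- by move=> v w; rewrite mulrC dual_le.
- by move=> v w w'; rewrite dual_linearZ dual_additive mulrC.
- by move=> v w w'; rewrite dual_additive dual_linearN.
- move=> v; have [y] := duality_map_onto v (@complete_seq_complete R X) Xuc.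
  by rewrite addrC; exists y.
Qed.

Lemma pairingB (f g : dual X) (x y : X) :
  (f - g) (x - y) = f x - f y - g x + g y.
Proof. by rewrite dualDE dualNE !dual_additive !dual_linearN; lra. Qed.

Lemma fitzpatrick_min (A : X -> set (dual X)) (a0 : X) (a0' : dual X) :
  monotone A -> A a0 a0' ->
  exists (p : X) (p' : dual X) (m : R),
    (forall a a', A a a' ->
      `|p| ^+ 2 + `|p'| ^+ 2 + 2 * (a' p + p' a - a' a) <= m) /\
    forall (u : X) (u' : dual X) (s : R),
      (forall a a', A a a' ->
        `|u| ^+ 2 + `|u'| ^+ 2 + 2 * (a' u + u' a - a' a) <= s) -> m <= s.
Proof.
move=> Amono Aa0.
have fst_continuous (g : X -> R^o) (u : X * dual X) :
    {for u.1, continuous g} ->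
    {for u, continuous (fun v : X * dual X => g v.1)}.
  move=> cg; apply: (@continuous_comp (X * dual X)%type X R^o fst g) cg.
  exact: cvg_fst.
have snd_continuous (g : dual X -> R^o) (u : X * dual X) :
    {for u.2, continuous g} ->
    {for u, continuous (fun v : X * dual X => g v.2)}.
  move=> cg; apply: (@continuous_comp (X * dual X)%type (dual X) R^o snd g) cg.
  exact: cvg_snd.
pose Q (u : X * dual X) : R := `|u.1| ^+ 2 + `|u.2| ^+ 2.
pose l (i : {q : X * dual X | A q.1 q.2}) (u : X * dual X) : R :=
  2 * ((sval i).2 u.1 + u.2 (sval i).1 - (sval i).2 (sval i).1).
have [|||||||p [m [pm mle]]] := @affine_perturbation_min R _ Q _ l
  (prod_seq_complete (@complete_seq_complete R X) (@dual_seq_complete R X)).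
- exact: prod_sqnorm_midconvex.
- move=> u; apply: (@continuousD R R^o _ (fun u => `|u.1| ^+ 2)
    (fun u => `|u.2| ^+ 2)).
    by apply: (fst_continuous (fun x => `|x| ^+ 2)); exact: sqnorm_continuous.
  by apply: (snd_continuous (fun f => `|f| ^+ 2)); exact: sqnorm_continuous.
- move=> u; rewrite prod_normE /Q; case: (leP `|u.1| `|u.2|) => _.
    by rewrite lerDr sqr_ge0.
  by rewrite lerDl sqr_ge0.
- move=> i u v; rewrite /l.
  have -> : (2^-1 *: (u + v)).1 = 2^-1 *: (u.1 + v.1) by [].
  have -> : (2^-1 *: (u + v)).2 = 2^-1 *: (u.2 + v.2) by [].
  by rewrite dual_linearZ dual_additive dualZE dualDE; lra.
- move=> i u; apply: (@continuousZl_tmp R R^o _ (fun u : X * dual X =>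
    (sval i).2 u.1 + u.2 (sval i).1 - (sval i).2 (sval i).1)).
  have c1 : {for u, continuous (fun v : X * dual X => (sval i).2 v.1)}.
    by apply: (fst_continuous (sval i).2); exact: dual_continuous.
  have c2 : {for u, continuous (fun v : X * dual X => v.2 (sval i).1 : R^o)}.
    by apply: (snd_continuous (fun f => f (sval i).1)); exact: eval_continuous.
  apply: (@cvgB R R^o _ (nbhs u)); last exact: cvg_cst.
  exact: (@cvgD R R^o _ (nbhs u) _ _ _ _ _ c1 c2).
- exists (exist (fun q : X * dual X => A q.1 q.2) (a0, a0') Aa0).
  exists (2 * (`|a0'| + `|a0| + `|a0' a0|)) => u; rewrite /l /=.
  have u1 : `|u.1| <= `|u| by rewrite prod_normE le_max lexx.
  have u2 : `|u.2| <= `|u| by rewrite prod_normE le_max lexx orbT.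
  have := dual_norm_bound a0' u.1.
  rewrite -dual_normE ler_norml => /andP[h1 _].
  have := dual_norm_bound u.2 a0.
  rewrite -dual_normE ler_norml => /andP[h2 _].
  have := ler_norm (a0' a0); have := normr_ge0 (a0' a0).
  have : `|a0'| * `|u.1| <= `|a0'| * `|u| by rewrite ler_wpM2l.
  have : `|u.2| * `|a0| <= `|u| * `|a0| by rewrite ler_wpM2r.
  have := normr_ge0 u; have := normr_ge0 a0; have := normr_ge0 a0'; nra.
- exists (a0, a0'), (Q (a0, a0') + 2 * a0' a0) => -[[a a'] /= Aa].
  by rewrite /l /= lerD2l; have := Amono _ _ _ _ Aa0 Aa; rewrite pairingB; lra.
exists p.1, p.2, m; split=> [a a' Aa|u u' s us].
  exact: pm (exist (fun q : X * dual X => A q.1 q.2) (a, a') Aa).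
by apply: (mle (u, u')) => -[[a a'] /= Aa]; exact: us.
Qed.

(* Let [(p, p')] minimize [|p|^2 + |p'|^2 + 2 F], where [F] is the Fitzpatrick
   function of [A]. If [f] is dual to [p] and [w] to [p'], the optimality
   condition says that [(- w, - f)] is monotonically related to [A], hence
   belongs to [A], and the condition at this very point forces [f] to be dual
   to [- w]. *)
Lemma maximal_monotone_antidual (A : X -> set (dual X)) :
  monotone A ->
  (forall y y', (forall a a', A a a' -> 0 <= (y' - a') (y - a)) -> A y y') ->
  exists y y', A y y' /\ `|y| ^+ 2 + `|y'| ^+ 2 <= - 2 * y' y.
Proof.
move=> Amono Amax.
have [a0 [a0' Aa0]] : exists a a', A a a'.
  apply: contrapT => A0; apply: (A0); exists 0, 0.
  by apply: Amax => a a' Aa; case: A0; exists a, a'.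
have [p [p' [m [pm mle]]]] := fitzpatrick_min Amono Aa0.
pose r := (m - (`|p| ^+ 2 + `|p'| ^+ 2)) / 2.
have rge a a' : A a a' -> a' p + p' a - a' a <= r.
  by move=> /pm; rewrite /r; lra.
have rp : p' p <= r.
  rewrite leNgt; apply/negP => rlt; suff /rge : A p p' by lra.
  by apply: Amax => a a' /rge; rewrite pairingB; lra.
have [f pf] := duality_map_ex p.
have [w pw] := duality_map_onto p' (@complete_seq_complete R X) Xuc.
have pf' : `|p| = `|f|.
  exact: (@duality_norm R X (dual X) (fun x g => g x) (fun x g => dual_le g x)).
have pw' : `|w| = `|p'|.
  exact: (@duality_norm R X (dual X) (fun x g => g x) (fun x g => dual_le g x)).
have fp : `|p| ^+ 2 <= f p by move: pf; rewrite -pf'; lra.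
have pw2 : `|p'| ^+ 2 <= p' w by move: pw; rewrite pw'; lra.
have key a a' : A a a' ->
    r + `|p| ^+ 2 + `|p'| ^+ 2 <= f a + a' w + a' a.
  move=> Aa.
  suff : r <= f (a - p) + (a' - p') w + a' a.
    by rewrite dual_additive dual_linearN dualDE dualNE; lra.
  apply/ler_addgt0Pr => e e0; have e20 : 0 < e / 2 by lra.
  have [t1 t10 t1P] := sqnorm_dual_differentiable (a - p) pf e20.
  have [t2 t20 t2P] := dual_sqnorm_differentiable (a' - p') pw e20.
  have [t [t0 tle1 tt1 tt2]] :
      exists t : R, [/\ 0 < t, t <= 1, t < t1 & t < t2].
    pose t := Num.min 1 (Num.min t1 t2).
    have lt12 : 0 < t by rewrite !lt_min ltr01 t10.
    have h1 : t <= 1 by rewrite ge_min lexx.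
    have h2 : t <= t1 by rewrite !ge_min lexx orbT.
    have h3 : t <= t2 by rewrite !ge_min lexx !orbT.
    by exists (t / 2); split; lra.
  have := t1P t t0 tt1; have := t2P t t0 tt2.
  have : m <= `|p + t *: (a - p)| ^+ 2 + `|p' + t *: (a' - p')| ^+ 2 +
              (2 * (1 - t) * r + 2 * t * a' a).
    apply: mle => c c' Ac; apply: lerD; first exact: lexx.
    rewrite dual_linearD dualDE dualZE dual_additive dual_linearN dualDE dualNE.
    have := Amono _ _ _ _ Aa Ac; rewrite pairingB => h1.
    have : 0 <= t * (a' a - a' c - c' a + c' c) by rewrite mulr_ge0// ltW.
    have : (1 - t) * (c' p + p' c - c' c) <= (1 - t) * r.
      by rewrite ler_wpM2l ?rge//; lra.
    by lra.
  have -> : m = `|p| ^+ 2 + `|p'| ^+ 2 + 2 * r by rewrite /r; lra.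
  move=> h1 h2 h3.
  have : t * r <= t * (f (a - p) + (a' - p') w + a' a + e) by lra.
  by rewrite ler_pM2l.
have rpn : - (`|p| * `|p'|) <= p' p.
  have := dual_norm_bound p' p.
  by rewrite -dual_normE ler_norml mulrC => /andP[].
have fw : - (`|p| * `|p'|) <= f w.
  have := dual_norm_bound f w.
  by rewrite -dual_normE -pf' pw' ler_norml => /andP[].
have sq := sqr_ge0 (`|p| - `|p'|).
have Awf : A (- w) (- f).
  apply: Amax => a a' /key; rewrite pairingB !dualNE !dual_linearN; nra.
exists (- w), (- f); split=> //; rewrite !normrN -pf' pw'.
have := key _ _ Awf; rewrite !dualNE !dual_linearN; nra.
Qed.

Lemma maximal_monotone_mem (A : X -> set (dual X)) (y : X) (y' : dual X) :
  maximal_monotone A ->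
  (forall a a', A a a' -> 0 <= (y' - a') (y - a)) -> A y y'.
Proof.
move=> [Amono Amax] yA.
pose B u := [set u' | A u u' \/ u = y /\ u' = y'].
apply: contrapT => nA; apply: (Amax B); last first.
  split; first by move=> p Ap; left.
  by move=> /(_ (y, y')) BA; apply/nA/BA; right.
move=> a b a' b' [Aa|[-> ->]] [Ab|[-> ->]].
- exact: Amono.
- have := yA _ _ Aa; rewrite -(opprB y' a') -(opprB y a).
  by rewrite dual_linearN dualNE opprK.
- exact: yA.
- by rewrite !subrr.
Qed.

Lemma maximal_monotone_duality_onto (A : X -> set (dual X)) (x : X)
    (z : dual X) :
  maximal_monotone A -> exists y y', A y y' /\
    `|y - x| ^+ 2 + `|z - y'| ^+ 2 <= 2 * (z - y') (y - x).
Proof.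
move=> Amm.
pose B u := [set u' | A (u + x) (u' + z)].
have shiftB (V : zmodType) (u v w : V) : u + w - (v + w) = u - v.
  by rewrite opprD addrACA subrr addr0.
have [u v u' v' Bu Bv|u u' uB|v [v' [Bv vv']]] := @maximal_monotone_antidual B.
- by have := Amm.1 _ _ _ _ Bu Bv; rewrite !shiftB.
- apply: (@maximal_monotone_mem A) => // a a' Aa.
  rewrite -(subrK x a) -(subrK z a') !shiftB.
  by apply: uB; rewrite /B /= !subrK.
exists (v + x), (v' + z); split=> //.
by rewrite addrK opprD addrCA subrr addr0 normrN dualNE; lra.
Qed.

Lemma maximal_monotone_closed (A : X -> set (dual X)) (x : X) (x' : dual X) :
  maximal_monotone A ->
  (forall e : R, 0 < e ->
    exists y y', [/\ A y y', `|y - x| < e & `|y' - x'| < e]) ->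
  A x x'.
Proof.
move=> Amm near; apply: maximal_monotone_mem => // a a' Aa.
rewrite leNgt; apply/negP; set k := (x' - a') (x - a) => k0.
pose K := `|x - a| + `|x' - a'| + 1.
have K0 : 0 < K by rewrite ltr_wpDl ?addr_ge0.
have e0 : 0 < Num.min 1 (- k / K) by rewrite lt_min ltr01 divr_gt0// oppr_gt0.
have [y [y' [Ay]]] := near _ e0.
rewrite !lt_min !ltr_pdivlMr// => /andP[y1 yk] /andP[y'1 y'k].
have := Amm.1 _ _ _ _ Ay Aa.
have -> : (y' - a') (y - a) = k + (y' - x') (x - a) + (y' - a') (y - x).
  by rewrite /k !(dual_additive, dual_linearN, dualDE, dualNE); ring.
pose e := Num.max `|y - x| `|y' - x'|.
have e1 : `|y - x| <= e by rewrite le_max lexx.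
have e2 : `|y' - x'| <= e by rewrite le_max lexx orbT.
have eK : e * K < - k by rewrite /e; case: (leP `|y - x| `|y' - x'|).
have h1 : (y' - x') (x - a) <= e * `|x - a|.
  by apply: le_trans (dual_le _ _) _; rewrite mulrC ler_wpM2r.
have h2 : (y' - a') (y - x) <= e * (`|x' - a'| + 1).
  apply: le_trans (dual_le _ _) _; apply: ler_pM => //.
  rewrite -(subrKA x' y' (- a')) addrC; apply: le_trans (ler_normD _ _) _.
  by rewrite lerD2l ltW.
rewrite leNgt => /negP; apply.
apply: le_lt_trans (lerD (lerD (lexx k) h1) h2) _.
by rewrite -addrA -mulrDr addrA addrC -ltrBrDr sub0r.
Qed.

End Surjectivity.

Theorem corollary3p1 (R : realType) (X : completeNormedModType R)
  (X_uc : uniformly_convex X) (dualX_uc : uniformly_convex (dual X))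
  (A : X -> set (dual X)) (A_mm : maximal_monotone A)
  (x : X) (x_dom : operator_dom A x) :
  boundary (A x) = punctured_Limsup A x.
Proof.
apply/seteqP; split=> x' /=.
- move=> [clx' nintx'].
  have Axx' : A x x'.
    apply: maximal_monotone_closed => // e e0.
    have [z' [Az' /=]] := clx' _ (nbhsx_ballx x' e e0).
    rewrite -ball_normE /= distrC => zx; exists x, z'.
    by rewrite subrr normr0.
  have step n : exists yy : X * dual X, [/\ yy.1 <> x, A yy.1 yy.2,
      `|yy.1 - x| < n.+1%:R^-1 :> R & `|yy.2 - x'| < 2 * n.+1%:R^-1 :> R].
    have n0 : 0 < n.+1%:R^-1 :> R by rewrite invr_gt0.
    have [z zx nAz] : exists2 z, `|z - x'| < n.+1%:R^-1 :> R & ~ A x z.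
      apply: contrapT => nz; apply: nintx'; apply/nbhs_ballP.
      exists n.+1%:R^-1 => // z; rewrite -ball_normE /= distrC => zx.
      by apply: contrapT => nAz; apply: nz; exists z.
    have [y [y' [Ay yz]]] :=
      maximal_monotone_duality_onto X_uc dualX_uc x z A_mm.
    have yz' := @duality_norm R X (dual X) (fun x g => g x)
      (fun x g => dual_le g x) _ _ yz.
    have yx : `|y - x| <= `|z - x'|.
      have := A_mm.1 _ _ _ _ Ay Axx'.
      have -> : (y' - x') (y - x) = (z - x') (y - x) - (z - y') (y - x).
        by rewrite !(dualDE, dualNE); lra.
      have := dual_le (z - x') (y - x); rewrite -yz' in yz.
      have [->|] := eqVneq (y - x) 0; first by rewrite normr0.
      rewrite -normr_gt0 => h0 h1 h2; rewrite -(ler_pM2l h0); lra.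
    exists (y, y') => /=; split=> //; last 2 first.
    - exact: le_lt_trans zx.
    - rewrite -(subrKA z) addrC; apply: le_lt_trans (ler_normD _ _) _.
      rewrite (distrC y') -yz'; move: zx.
      by generalize (n.+1%:R^-1 : R) => *; lra.
    move=> yxE; apply: nAz; move: yz'; rewrite yxE subrr normr0 => /esym/eqP.
    by rewrite normr_eq0 subr_eq0 => /eqP->; rewrite -yxE.
  have [yy yyP] := choice step.
  exists (fun n => (yy n).1), (fun n => (yy n).2); split.
  + apply/cvgrPdist_lt => e e0.
    have := near_infty_natSinv_lt (PosNum e0).
    apply: filterS => n ne; rewrite distrC; have [_ _ h _] := yyP n.
    exact: lt_trans h ne.
  + apply/cvgrPdist_lt => e e0; have e20 : 0 < e / 2 by lra.
    have := near_infty_natSinv_lt (PosNum e20).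
    apply: filterS => n /= ne; rewrite distrC; have [_ _ _ h] := yyP n.
    by apply: lt_trans h _; rewrite mulrC -ltr_pdivlMr.
  + by move=> n; have [? ? _ _] := yyP n.
- move=> [y [y' [/cvgrPdist_lt yx /cvgrPdist_lt y'x yP]]].
  have near e : 0 < e -> exists n, `|y n - x| < e /\ `|y' n - x'| < e.
    move=> e0; have [n [h1 h2]] := filter_ex (filterI (yx _ e0) (y'x _ e0)).
    by exists n; rewrite distrC (distrC _ x').
  split.
    apply: subset_closure; apply: maximal_monotone_closed => //.
    move=> e /near[n [h1 h2]].
    by exists (y n), (y' n); rewrite h1 h2; split=> //; exact: (yP n).2.
  move=> /nbhs_ballP[r /= r0 rA].
  have r20 : 0 < r / 2 by lra.
  have [n [_ h]] := near _ r20; have [ynx Ayn] := yP n.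
  have [g gx gn] := norming_functional (y n - x).
  have gn1 : `|g| <= 1 by apply: dual_norm_le => v; apply: le_trans.
  have Az : A x (x' + (r / 2) *: g).
    apply: rA; rewrite -ball_normE /= opprD addrA subrr sub0r normrN normrZ.
    by rewrite gtr0_norm//; nra.
  have := A_mm.1 _ _ _ _ Ayn Az.
  rewrite opprD addrA dualDE dualNE dualZE gx.
  have := dual_le (y' n - x') (y n - x).
  have : 0 < `|y n - x| by rewrite normr_gt0 subr_eq0; apply/eqP.
  by nra.
Qed.
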